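(* Let $f$ be a proof net on a cut sequent $\Gamma$ of multiplicative linear logic with units. Then its (path-composition) normal form $|f|$ on $|\Gamma|$ is precisely the normal form of $f$ under one-step cut elimination, i.e. the result of eliminating cuts one at a time from $f$ until no cuts remain. In particular, $|f|$ is a proof net on $|\Gamma|$.
   Context: Formulas (MLL) are built from literals (propositional variables $P,Q,\dots$ and their duals $P^\bot,Q^\bot,\dots$) and units $1,\bot$ by the binary connectives $\otimes$ (tensor) and $\wp$ (par, the multiplicative disjunction of linear logic). An atom is a literal or a unit. Negation $(-)^\bot$ extends to all formulas by $P^{\bot\bot}=P$, $\bot^\bot=1$, $1^\bot=\bot$, $(A\otimes B)^\bot=A^\bot\wp B^\bot$, $(A\wp B)^\bot=A^\bot\otimes B^\bot$. A formula is identified with its parse tree (leaves labelled by atoms, internal vertices by connectives). A leaf (or atom) is positive if labelled by a propositional variable or $1$, and negative if labelled by a dual $P^\bot$ or by $\bot$. A sequent is a non-empty disjoint union of formulas (a labelled forest). A cut pair on $A$ is the disjoint union of $A$ and $A^\bot$ together with an undirected edge (a cut) between their roots. A cut sequent is a disjoint union of a sequent and zero or more cut pairs. A switching of a cut sequent is any subgraph obtained by deleting, for each $\wp$ vertex, one of its two argument edges. A leaf function on a cut sequent is a function from its negative leaves to its positive leaves. A proof net on a cut sequent $\Gamma$ is a leaf function $f$ on $\Gamma$ such that: (Matching) for every propositional variable $P$, $f$ restricts to a bijection between the $P^\bot$-labelled leaves and the $P$-labelled leaves of $\Gamma$; (Switching) for every switching $\Gamma'$ of $\Gamma$, the undirected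 graph obtained by adding the edges $\{l,f(l)\}$ of $f$ to $\Gamma'$ is a tree (acyclic and connected; parallel edges count as a cycle). Eliminating a cut (one step). Let $f$ be a proof net on the cut sequent consisting of $\Gamma$ and a cut pair on $A$. - Atom: if $A$ is an atom, say (without loss of generality) positive, delete the cut pair $A,A^\bot$, and reset every edge of $f$ targeting the leaf $A$ to target $f(A^\bot)$ instead. - Compound: if $A$ is compound, say (without loss of generality) $A=B\otimes C$ and $A^\bot=B^\bot\wp C^\bot$, replace the cut pair on $A$ by two cut pairs, one on $B$ (joining the roots of $B$ and $B^\bot$) and one on $C$ (joining the roots of $C$ and $C^\bot$); the leaves and the function $f$ are unchanged. Path-composition normal form. For $l$ the $i$-th leaf of a formula $A$ in a cut pair on $A$, $l^\bot$ denotes the $i$-th leaf of $A^\bot$ (and vice versa). The normal form $|\Gamma|$ of a cut sequent $\Gamma$ is the sequent obtained by deleting all cut pairs. For a proof net $f$ on $\Gamma$, $|f|$ is the leaf function on $|\Gamma|$ obtained by replacing every set of edges $\langle l_0,l_1\rangle,\langle l_1^\bot,l_2\rangle,\langle l_2^\bot,l_3\rangle,\dots,\langle l_{n-1}^\bot,l_n\rangle$ of $f$ in which only $l_0$ and $l_n$ occur in $|\Gamma|$ by the single edge $\langle l_0,l_n\rangle$ (here $\langle l,m\rangle$ is an edge of $f$ when $f(l)=m$). *)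

(* Defs.v *)
From HB Require Import structures.
From mathcomp Require Import all_boot.
From Stdlib Require Import Relation_Operators.

Set Implicit Arguments.
Unset Strict Implicit.
Unset Printing Implicit Defensive.

Inductive atom (X : Type) := Var (P : X) | DualVar (P : X) | One | Bot.
Arguments One {X}.
Arguments Bot {X}.

Inductive formula (X : Type) :=
  | Atom (a : atom X)
  | Tensor (A B : formula X)
  | Par (A B : formula X).

Section Formulas.
Variable X : Type.

Definition dual_atom (a : atom X) : atom X :=
  match a with
  | Var P => DualVar P
  | DualVar P => Var P
  | One => Bot
  | Bot => One
  end.

Fixpoint dual (A : formula X) : formula X :=
  match A with
  | Atom a => Atom (dual_atom a)
  | Tensor A B => Par (dual A) (dual B)
  | Par A B => Tensor (dual A) (dual B)
  end.

Definition positive (a : atom X) : bool :=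
  match a with Var _ | One => true | DualVar _ | Bot => false end.

Definition atom_code (a : atom X) : bool * option X :=
  match a with
  | Var P => (true, Some P)
  | DualVar P => (false, Some P)
  | One => (true, None)
  | Bot => (false, None)
  end.

Definition atom_decode (c : bool * option X) : atom X :=
  match c with
  | (true, Some P) => Var P
  | (false, Some P) => DualVar P
  | (true, None) => One
  | (false, None) => Bot
  end.

Lemma atom_codeK : cancel atom_code atom_decode.
Proof. by case. Qed.

Fixpoint formula_code (A : formula X) : GenTree.tree (atom X) :=
  match A with
  | Atom a => GenTree.Leaf a
  | Tensor A B => GenTree.Node 0 [:: formula_code A; formula_code B]
  | Par A B => GenTree.Node 1 [:: formula_code A; formula_code B]
  end.

Fixpoint formula_decode (c : GenTree.tree (atom X)) : option (formula X) :=
  match c with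
  | GenTree.Leaf a => Some (Atom a)
  | GenTree.Node n [:: c1; c2] =>
      match formula_decode c1, formula_decode c2 with
      | Some A, Some B => Some (if n == 0 then Tensor A B else Par A B)
      | _, _ => None
      end
  | _ => None
  end.

Lemma formula_codeK : pcancel formula_code formula_decode.
Proof. by elim=> //= A -> B ->. Qed.

End Formulas.

HB.instance Definition _ (X : eqType) :=
  Equality.copy (atom X) (can_type (@atom_codeK X)).
HB.instance Definition _ (X : eqType) :=
  Equality.copy (formula X) (pcan_type (@formula_codeK X)).

(* Parse trees whose vertices are explicit elements of V, so that the leaves  *)
(* keep their identity when a cut is eliminated.                              *)

Inductive tree (V X : Type) :=
  | TLeaf (v : V) (a : atom X)
  | TTensor (v : V) (t u : tree V X)
  | TPar (v : V) (t u : tree V X).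

(* A cut pair is the pair of its two trees.  Disjointness of the union,       *)
(* non-emptiness and duality of the cut pairs are imposed by [cut_sequent].   *)

Record forest (V X : Type) := Forest {
  concl : seq (tree V X);
  cuts : seq (tree V X * tree V X)
}.

Section ProofNets.
Variables (V : finType) (X : eqType).
Implicit Types (t u : tree V X) (G : forest V X) (f : {set V * V}).

Fixpoint formula_of t : formula X :=
  match t with
  | TLeaf _ a => Atom a
  | TTensor _ t u => Tensor (formula_of t) (formula_of u)
  | TPar _ t u => Par (formula_of t) (formula_of u)
  end.

Definition root t : V :=
  match t with TLeaf v _ | TTensor v _ _ | TPar v _ _ => v end.

Fixpoint vertices t : seq V :=
  match t with
  | TLeaf v _ => [:: v]
  | TTensor v t u | TPar v t u => v :: vertices t ++ vertices u
  end.

Fixpoint leaves t : seq (V * atom X) :=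
  match t with
  | TLeaf v a => [:: (v, a)]
  | TTensor _ t u | TPar _ t u => leaves t ++ leaves u
  end.

Definition trees G : seq (tree V X) :=
  concl G ++ flatten [seq [:: p.1; p.2] | p <- cuts G].

Definition fvertices G : seq V := flatten (map vertices (trees G)).
Definition fleaves G : seq (V * atom X) := flatten (map leaves (trees G)).

Definition cut_sequent G : Prop :=
  [/\ concl G <> [::],
      uniq (fvertices G)
    & all (fun p => formula_of p.2 == dual (formula_of p.1)) (cuts G)].

Definition neg_leaf G (l : V) : Prop :=
  exists2 a, (l, a) \in fleaves G & ~~ positive a.
Definition pos_leaf G (l : V) : Prop :=
  exists2 a, (l, a) \in fleaves G & positive a.

(* A function is given by its graph: (l, m) \in f means f(l) = m.             *)

Definition leaf_function G f : Prop :=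
  (forall l m, (l, m) \in f -> neg_leaf G l /\ pos_leaf G m) /\
  (forall l, neg_leaf G l -> exists! m, (l, m) \in f).

Definition matching G f : Prop :=
  forall P : X,
    (forall l m, (l, DualVar P) \in fleaves G -> (l, m) \in f ->
       (m, Var P) \in fleaves G) /\
    (forall m, (m, Var P) \in fleaves G ->
       exists! l, (l, DualVar P) \in fleaves G /\ (l, m) \in f).

(* A multigraph is given by the list of its vertices and the list of its      *)
(* edges; the orientation of an edge (x, y) is irrelevant.                    *)

Definition adj (es : seq (V * V)) : rel V :=
  fun x y => ((x, y) \in es) || ((y, x) \in es).

Definition connected (vs : seq V) (es : seq (V * V)) : Prop :=
  {in vs &, forall x y, connect (adj es) x y}.

(* The three clauses exclude cycles of length 1, 2 and at least 3.            *)
Definition acyclic (es : seq (V * V)) : Prop :=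
  [/\ all (fun e => e.1 != e.2) es,
      pairwise (fun e e' => (e' != e) && (e' != (e.2, e.1))) es
    & forall c : seq V, uniq c -> 2 < size c -> ~~ cycle (adj es) c].

Definition is_tree vs es : Prop := connected vs es /\ acyclic es.

(* If [s v] then the right argument edge of the par vertex v is deleted, else *)
(* the left one; the values of [s] elsewhere are irrelevant.                  *)
Fixpoint switched_edges (s : V -> bool) t : seq (V * V) :=
  match t with
  | TLeaf _ _ => [::]
  | TTensor v t u =>
      [:: (v, root t), (v, root u) & switched_edges s t ++ switched_edges s u]
  | TPar v t u =>
      (v, if s v then root t else root u)
        :: switched_edges s t ++ switched_edges s u
  end.

Definition switching_edges (s : V -> bool) G : seq (V * V) :=
  flatten (map (switched_edges s) (trees G))
    ++ [seq (root p.1, root p.2) | p <- cuts G].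

Definition switching_condition G f : Prop :=
  forall s : V -> bool, is_tree (fvertices G) (switching_edges s G ++ enum f).

Definition proof_net G f : Prop :=
  [/\ cut_sequent G, leaf_function G f, matching G f & switching_condition G f].

(* Elimination of an atomic cut between the positive leaf x and the negative  *)
(* leaf y: y is removed from the domain, edges into x are sent to f(y).       *)
Definition reset f (x y : V) : {set V * V} :=
  [set e : V * V | (e.1 != y) &&
     (((e.2 != x) && (e \in f)) || (((e.1, x) \in f) && ((y, e.2) \in f)))].

(* a cut pair is unordered *)
Definition cut_between (p : tree V X * tree V X) t u : Prop :=
  p = (t, u) \/ p = (u, t).

Inductive cut_step :
    forest V X * {set V * V} -> forest V X * {set V * V} -> Prop :=
  | StepAtom D f c1 p c2 x y a :
      proof_net (Forest D (c1 ++ p :: c2)) f ->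
      positive a ->
      cut_between p (TLeaf x a) (TLeaf y (dual_atom a)) ->
      cut_step (Forest D (c1 ++ p :: c2), f)
               (Forest D (c1 ++ c2), reset f x y)
  | StepCompound D f c1 p c2 v w tB tC uB uC :
      proof_net (Forest D (c1 ++ p :: c2)) f ->
      cut_between p (TTensor v tB tC) (TPar w uB uC) ->
      cut_step (Forest D (c1 ++ p :: c2), f)
               (Forest D (c1 ++ [:: (tB, uB), (tC, uC) & c2]), f).

Definition cut_normal_form_of (S S' : forest V X * {set V * V}) : Prop :=
  clos_refl_trans_1n _ cut_step S S' /\ forall S'', ~ cut_step S' S''.

Definition cut_terminating (S : forest V X * {set V * V}) : Prop :=
  Acc (fun S2 S1 => cut_step S1 S2) S.

Definition erase_cuts G : forest V X := Forest (concl G) [::].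

Definition leaf_names t : seq V := map fst (leaves t).

(* l and l' are the i-th leaves of the two trees of some cut pair, i.e. l' is *)
(* the leaf written l^\bot.                                                   *)
Definition dual_leaf G (l l' : V) : bool :=
  has (fun p => ((l, l') \in zip (leaf_names p.1) (leaf_names p.2)) ||
                ((l', l) \in zip (leaf_names p.1) (leaf_names p.2))) (cuts G).

(* from l_i^\bot to l_{i+1}^\bot, where f(l_i^\bot) = l_{i+1} *)
Definition through_cut G f : rel V :=
  fun l k => [exists m, ((l, m) \in f) && dual_leaf G m k].

(* The edges <l_0, l_n> with l_0 and l_n in the conclusions such that         *)
(* <l_0, l_1>, <l_1^\bot, l_2>, ..., <l_{n-1}^\bot, l_n> are edges of f; the  *)
(* leaves in between lie in cut pairs by definition of [dual_leaf].           *)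
Definition path_normal_form G f : {set V * V} :=
  [set e : V * V |
     [&& e.1 \in map fst (fleaves (erase_cuts G)),
         e.2 \in map fst (fleaves (erase_cuts G))
       & [exists k, connect (through_cut G f) e.1 k && ((k, e.2) \in f)]]].

End ProofNets.

(* Main.v *)
From mathcomp Require Import all_boot.
From Stdlib Require Import Relation_Operators.
Require Import Defs.

(** A connected multigraph on n vertices is a tree exactly when it has n - 1
edges.  With this criterion one cut elimination step preserves the switching
condition: an atomic step contracts a path of two edges, and in a compound step
removing the two vertices of the cut leaves three components, which the two
switchings of the removed par vertex locate.  One step also preserves the
path-composition normal form and removes two vertices, and a proof net with a
cut always has a step.  On a cut-free proof net f the path-composition normal
form is f itself, so every reduction ends in it. *)

Set Implicit Arguments.
Unset Strict Implicit.
Unset Printing Implicit Defensive.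

(** * Trees as connected graphs with n - 1 edges *)

(** Connectedness is easy to transport along a rewriting of edges, since walks are pushed forward
    edge by edge; acyclicity is not. Counting turns acyclicity into arithmetic. An atomic step
    removes two vertices, the cut edge and one edge of [f]. A compound step removes two vertices and
    four edges (the cut, two at the tensor, one at the par) and adds two cut edges. In both cases
    the balance between vertices and edges is kept. The same count shows that [f] cannot send the
    negative leaf of an atomic cut to its positive partner, so that resetting is well defined. *)

Section Graphs.
Variable V : finType.
Implicit Types (es : seq (V * V)) (vs : seq V).

Lemma adj_sym es : symmetric (adj es).
Proof. by move=> x y; rewrite /adj orbC. Qed.

Lemma connect_adjC es x y : connect (adj es) x y = connect (adj es) y x.
Proof. exact: sym_connect_sym (adj_sym es) x y. Qed.

Lemma adj_cons e es x y :
  adj (e :: es) x y = [|| (x, y) == e, (y, x) == e | adj es x y].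
Proof. by rewrite /adj !inE orbACA -orbA. Qed.

Lemma connect_adj_consW e es x y :
  connect (adj es) x y -> connect (adj (e :: es)) x y.
Proof.
by apply: connect_sub => u v uv; apply: connect1; rewrite adj_cons uv !orbT.
Qed.

(** A walk can be shortened so as to use the new edge at most once, in one of its two directions. *)
Lemma connect_adj_cons e es x y :
  connect (adj (e :: es)) x y =
  [|| connect (adj es) x y,
      connect (adj es) x e.1 && connect (adj es) e.2 y
    | connect (adj es) x e.2 && connect (adj es) e.1 y].
Proof.
case: e => a b /=; apply/idP/idP; last first.
  have ab : connect (adj ((a, b) :: es)) a b.
    by apply: connect1; rewrite adj_cons eqxx.
  case/or3P=> [/connect_adj_consW // | |] /andP[/connect_adj_consW xa
    /connect_adj_consW bY]; apply: connect_trans (xa _) _;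
    apply: connect_trans (bY _) => //.
  by rewrite connect_adjC.
case/connectP=> p; elim: p x => [|z p IH] x /=; first by move=> _ ->; rewrite connect0.
case/andP=> xz /IH{}IH /IH{IH}; rewrite adj_cons in xz.
case/or3P: xz => [/eqP[-> ->]|/eqP[-> ->]|/connect1 xz].
- case/or3P=> [->|/andP[_ ->]|/andP[_ ->]]; rewrite ?connect0 ?orbT //.
- case/or3P=> [->|/andP[_ ->]|/andP[_ ->]]; rewrite ?connect0 ?orbT //.
- case/or3P=> [h|/andP[h ->]|/andP[h ->]]; rewrite (connect_trans xz h) ?orbT //.
Qed.

Definition component es x : {set V} := [set y | connect (adj es) x y].

Definition components vs es : {set {set V}} := [set component es x | x in vs].

Lemma component_eq es x y :
  (component es x == component es y) = connect (adj es) x y.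
Proof.
apply/eqP/idP => [/setP/(_ y)|xy]; first by rewrite !inE connect0.
apply/setP=> z; rewrite !inE; apply/idP/idP; apply: connect_trans => //.
by rewrite connect_adjC.
Qed.

(** A new edge either lies inside one component or merges exactly two; the boolean, read as 0 or 1,
    tells which. *)
Lemma card_components_cons vs e es : e.1 \in vs -> e.2 \in vs ->
  #|components vs (e :: es)| + ~~ connect (adj es) e.1 e.2
    = #|components vs es|.
Proof.
case: e => a b /= avs bvs; have [ab|nab] := boolP (connect (adj es) a b).
  rewrite addn0; congr #|pred_of_set _|; apply: eq_in_imset => x _.
  apply/setP=> y; rewrite !inE connect_adj_cons /=.
  apply/idP/idP => [|->//]; case/or3P => // /andP[xa bY].
    exact: connect_trans xa (connect_trans ab bY).
  by apply: connect_trans xa (connect_trans _ bY); rewrite connect_adjC.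
have -> : components vs ((a, b) :: es) =
    (component es a :|: component es b)
      |: (components vs es :\ component es a :\ component es b).
  have cE x : component ((a, b) :: es) x =
      if connect (adj es) x a || connect (adj es) x b
      then component es a :|: component es b else component es x.
    apply/setP=> y; rewrite !inE connect_adj_cons /=.
    have [xa|nxa] /= := boolP (connect _ x a).
      rewrite !inE; have -> : connect (adj es) x b = false.
        apply/negbTE; apply: contra nab; apply: connect_trans.
        by rewrite connect_adjC.
      have /eqP/setP/(_ y) : component es x == component es a by rewrite component_eq.
      by rewrite !inE orbF => ->.
    have [xb|nxb] /= := boolP (connect _ x b); rewrite !inE ?orbF //.
    have /eqP/setP/(_ y) : component es x == component es b by rewrite component_eq.
    by rewrite !inE => ->; rewrite orbC.
  apply/setP=> C; rewrite !inE; apply/imsetP/idP.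
    case=> x xvs ->; rewrite cE; case: ifPn => [_|]; first by rewrite eqxx.
    by rewrite negb_or !component_eq => /andP[-> ->]; rewrite imset_f ?orbT.
  case/orP=> [/eqP->|]; first by exists a; rewrite // cE connect0.
  case/and3P=> nb na /imsetP[x xvs Cx]; exists x => //; rewrite cE Cx.
  by move: nb na; rewrite Cx !component_eq => /negbTE-> /negbTE->.
rewrite cardsU1.
(* An old component equal to this union would contain [a], hence be the component of [a], which has
   been taken out. *)
have -> : component es a :|: component es b
    \notin components vs es :\ component es a :\ component es b.
  rewrite !inE; apply/negP=> /and3P[_ + /imsetP[x _ /setP Ux]].
  move/eqP; apply; apply/setP=> y; rewrite Ux; move: y; apply/setP/eqP.
  by rewrite component_eq; have := Ux a; rewrite !inE connect0 => <-.
rewrite (cardsD1 (component es a) (components _ _)).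
rewrite (cardsD1 (component es b) (components vs es :\ _)).
rewrite imset_f // !inE component_eq connect_adjC nab imset_f //=.
by rewrite addn1 add1n.
Qed.

Lemma card_components_nil vs : uniq vs -> #|components vs [::]| = size vs.
Proof.
move=> uvs; rewrite card_imset; first exact/card_uniqP.
move=> x y /eqP; rewrite component_eq => /connectP[[|z p] //=].
Qed.

(** Adding the edges from the end of the list, each one merges two components. The recursion follows
    the order of the list, but by [acyclicP] its value does not depend on it. *)
Fixpoint successive_bridges es :=
  if es is e :: es' then
    ~~ connect (adj es') e.1 e.2 && successive_bridges es'
  else true.

Definition endpoints_in vs es :=
  all (fun e : V * V => (e.1 \in vs) && (e.2 \in vs)) es.

(** Without edges there are [size vs] components, and each edge lowers their number by at most one;
    equality means that every edge does lower it. *)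
Lemma card_components vs es : uniq vs -> endpoints_in vs es ->
  size vs <= #|components vs es| + size es
  /\ (size vs == #|components vs es| + size es) = successive_bridges es.
Proof.
move=> uvs; elim: es => [|e es IH] /=.
  by rewrite card_components_nil // addn0 eqxx.
case/andP=> /andP[e1 e2] /IH[le <-].
rewrite -(card_components_cons es e1 e2) in le *.
case: (connect _ _ _) le; rewrite ?addn0 ?addn1 ?addnS ?addSn /=.
  by move=> le; rewrite leqW // ltn_eqF.
by move=> le; split.
Qed.

(** A simple path between the ends of [e] that avoids [e] closes up to a cycle with it; conversely,
    a cycle through [e] leaves such a path when [e] is dropped. *)
Lemma acyclicP es : acyclic es <-> successive_bridges es.
Proof.
split; elim: es => [|e es IH] //=.
- case=> /= /andP[ne1 ne] /andP[pe pes] cyc; apply/andP; split; last first.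
    apply: IH; split=> // c uc sc; apply: contra (cyc c uc sc).
    by apply: sub_cycle => x y xy; rewrite adj_cons xy !orbT.
  apply/negP=> /connectP[p pp lp]; case/shortenP: pp lp => p' pp up _ lp.
  (* A path with no edge makes [e] a loop, one edge makes it parallel to another, and two or more
     give a cycle on at least three vertices: one case for each clause of [acyclic]. *)
  case: p' pp up lp => [|z [|t p']] //= pp up lp.
  + by rewrite lp eqxx in ne1.
  + move: pp; rewrite /adj -lp andbT; case/orP=> /(allP pe) /=.
      by rewrite -surjective_pairing eqxx.
    by rewrite eqxx andbF.
  + have /negP := cyc [:: e.1, z, t & p'] up isT; apply.
    rewrite (cycle_path e.1) /= -lp adj_cons -surjective_pairing eqxx !orbT /=.
    move: pp => /and3P[h1 h2 h3]; rewrite !adj_cons h1 h2 !orbT /=.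
    by apply: sub_path h3 => x y xy; rewrite adj_cons xy !orbT.
- by move=> _; split=> // -[|x [|y c]].
- case/andP=> ne /IH [ne1 pes cyc]; split=> /=.
  + by rewrite ne1 andbT; apply: contra ne => /eqP->.
  + rewrite pes andbT; apply/allP=> e' e'es; apply/andP; split.
      apply: contra ne => /eqP <-; apply: connect1.
      by rewrite /adj -surjective_pairing e'es.
    apply: contra ne => /eqP E; apply: connect1.
    by rewrite /adj -E e'es orbT.
  + move=> c uc sc; apply/negP=> cc; have /negP := cyc c uc sc; apply.
    (* If some edge of the cycle is missing from [es], it must be [e]. The cycle is rotated to start
       there, and its remainder joins the ends of [e] within [es]. *)
    apply: cycle_from_next => // x xc; apply: contraNT ne => nadj.
    have [i q rc] := rot_to xc.
    have := next_rot i uc x; rewrite rc => nx.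
    move: uc sc cc nadj; rewrite -nx -(rot_uniq i) -(size_rot i) -(rot_cycle i).
    rewrite {}rc {nx}; case: q => [|z [|t q]] //= + _; rewrite eqxx.
    case/and3P; rewrite !inE !negb_or => /and3P[xz xt _] /andP[zt zq] _.
    case/and3P; rewrite adj_cons orbA => xze zt' tq nxz.
    rewrite -negb_or in nxz; rewrite {1}/adj (negbTE nxz) orbF in xze.
    (* [z] is an end of [e], so a walk that avoids [z] cannot use [e]. *)
    have eE : {in predC1 z &, adj (e :: es) =2 adj es}.
      move=> u v; rewrite !inE => uz vz; rewrite adj_cons; case/orP: xze => /eqP<-;
      by rewrite !xpair_eqE (negbTE uz) (negbTE vz) ?andbF.
    have zx : connect (adj es) z x.
      apply: (@connect_trans _ _ t).
        apply: connect1; move: zt'; rewrite adj_cons.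
        case/orP: xze => /eqP<-; rewrite !xpair_eqE;
        by rewrite (eq_sym z x) (eq_sym t x) (eq_sym t z) (negbTE xz) (negbTE xt)
          (negbTE zt) ?andbF.
      apply/connectP; exists (rcons q x); last by rewrite last_rcons.
      rewrite -(eq_in_path eE) //= eq_sym zt all_rcons /= xz; apply/allP=> u uq /=.
      by apply: contraNneq zq => <-.
    by case/orP: xze => /eqP<- //=; rewrite connect_adjC.
Qed.

Lemma card_components_connected vs es : vs != [::] -> connected vs es ->
  #|components vs es| = 1.
Proof.
case: vs => // x vs _ con; rewrite -(cards1 (component es x)); congr #|pred_of_set _|.
apply/setP=> C; rewrite inE; apply/imsetP/eqP => [[y yvs ->]|->]; last first.
  by exists x; rewrite // mem_head.
by apply/eqP; rewrite component_eq; apply: con; rewrite ?mem_head.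
Qed.

Lemma is_tree_count vs es : uniq vs -> vs != [::] -> endpoints_in vs es ->
  is_tree vs es <-> connected vs es /\ size vs = (size es).+1.
Proof.
move=> uvs vs0 evs; have [_ E] := card_components uvs evs.
split=> -[con H]; split=> //.
  by move/acyclicP: H; rewrite -E (card_components_connected vs0 con) => /eqP.
by apply/acyclicP; rewrite -E (card_components_connected vs0 con) H.
Qed.

Lemma connected_size vs es : uniq vs -> vs != [::] -> endpoints_in vs es ->
  connected vs es -> size vs <= (size es).+1.
Proof.
move=> uvs vs0 evs con; have [+ _] := card_components uvs evs.
by rewrite card_components_connected.
Qed.

End Graphs.

(** * Transport of connectedness along contractions *)

Section Contraction.
Variable V : finType.

(** Walks are pushed forward by [h]. An edge may collapse to a point or be replaced by a path, hence
    [connect] rather than [adj] in the hypothesis. *)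
Lemma connected_map (h : V -> V) (vs vs' : seq V) (es es' : seq (V * V)) :
  {subset vs' <= vs} -> {in vs', h =1 id} ->
  (forall u v, (u, v) \in es -> connect (adj es') (h u) (h v)) ->
  connected vs es -> connected vs' es'.
Proof.
move=> sub hid hes con x y xvs yvs; rewrite -(hid x) // -(hid y) //.
have := con x y (sub _ xvs) (sub _ yvs); case/connectP=> p.
elim: p x {xvs} => [|z p IH] x /=; first by move=> _ ->; rewrite connect0.
case/andP=> xz /IH{IH} H /H{H}; apply: connect_trans.
by case/orP: xz => /hes //; rewrite connect_adjC.
Qed.

Lemma connected_adj (vs vs' : seq V) (es es' : seq (V * V)) :
  vs =i vs' -> adj es =2 adj es' -> connected vs es -> connected vs' es'.
Proof.
move=> evs ees con x y; rewrite -!evs => xvs yvs.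
by rewrite -(eq_connect ees); apply: con.
Qed.

(* [v] and [w] are the tensor and the par vertex of a compound cut.  Removing *)
(* them leaves three components, one containing [b], one [c], and, by the two *)
(* switchings of [w], one containing both [b'] and [c'].                      *)
Lemma connected_tensor_par (vs : seq V) es v w b c b' c' :
  uniq (v :: w :: vs) -> endpoints_in vs es ->
  b \in vs -> c \in vs -> b' \in vs -> c' \in vs ->
  size vs = (size es).+3 ->
  connected (v :: w :: vs) [:: (v, w), (v, b), (v, c), (w, b') & es] ->
  connected (v :: w :: vs) [:: (v, w), (v, b), (v, c), (w, c') & es] ->
  connected vs [:: (b, b'), (c, c') & es].
Proof.
rewrite /= inE negb_or => /and3P[/andP[vw vvs] wvs uvs] ees bvs cvs b'vs c'vs sz.
(* Both [v] and [w] are contracted onto [b], which turns the edges at [c] and [d] into edges from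
   [b]. *)
have contract d : d \in vs ->
    connected (v :: w :: vs) [:: (v, w), (v, b), (v, c), (w, d) & es] ->
    connected vs [:: (b, d), (b, c) & es].
  move=> dvs; pose h x := if (x == v) || (x == w) then b else x.
  have hid : {in vs, h =1 id}.
    move=> x xvs; rewrite /h; case: eqP xvs => [->|_]; first by rewrite (negbTE vvs).
    by case: eqP => [->|//]; rewrite (negbTE wvs).
  apply: (@connected_map h) => // [x xvs|x y]; first by rewrite !inE xvs !orbT.
  have hv : h v = b by rewrite /h eqxx.
  have hw : h w = b by rewrite /h eqxx orbT.
  rewrite !inE; case/or4P=> [||| /orP[|xyes]].
  - by case/eqP=> -> ->; rewrite hv hw.
  - by case/eqP=> -> ->; rewrite hv hid.
  - case/eqP=> -> ->; rewrite hv hid //; apply: connect1.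
    by rewrite /adj !inE eqxx orbT.
  - case/eqP=> -> ->; rewrite hw hid //; apply: connect1.
    by rewrite /adj !inE eqxx.
  - have /andP[/= xvs yvs] := allP ees _ xyes; rewrite !hid //; apply: connect1.
    by rewrite /adj !inE xyes !orbT.
move=> /(contract _ b'vs) con1 /(contract _ c'vs) con2.
have toF d x : connected vs [:: (b, d), (b, c) & es] -> x \in vs ->
    connect (adj ((b, c) :: es)) x b || connect (adj ((b, c) :: es)) x d.
  move=> con xvs; have := con x b xvs bvs; rewrite connect_adj_cons /=.
  by case/or3P => [->|/andP[->]|/andP[->]]; rewrite ?orbT.
(* Otherwise [(b, c) :: es] would connect [vs] with only [size vs - 2] edges. *)
have nb'b : ~~ connect (adj ((b, c) :: es)) b' b.
  apply/negP=> b'b.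
  have all_b x : x \in vs -> connect (adj ((b, c) :: es)) x b.
    move=> xvs; case/orP: (toF _ _ con1 xvs) => // xb'.
    exact: connect_trans xb' b'b.
  have con : connected vs ((b, c) :: es).
    move=> x y xvs yvs; apply: connect_trans (all_b x xvs) _.
    by rewrite connect_adjC all_b.
  have vs0 : vs != [::] by case: (vs) bvs.
  by have := connected_size uvs vs0 _ con; rewrite /= bvs cvs sz ltnn => /(_ ees).
(* By the second switching [b'] reaches [b] or [c'], and [b] is excluded. Passing through the edge
   [(b, c)] would also reach [b], so the path stays in [es]. *)
have b'c' : connect (adj es) b' c'.
  have := toF _ _ con2 b'vs; rewrite (negbTE nb'b) /= connect_adj_cons /=.
  case/or3P=> // /andP[h _]; case/negP: nb'b; first exact: connect_adj_consW.
  apply: connect_trans (connect_adj_consW _ h) _; rewrite connect_adjC.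
  by apply: connect1; rewrite adj_cons eqxx.
(* In the first contracted graph the edge from [b] to [c] is replaced by the path from [b] to [b'],
   to [c'], to [c]. *)
apply: (@connected_map id) con1 => // x y; set E := [:: _, (c, c') & _].
have sub u u' : connect (adj es) u u' -> connect (adj E) u u'.
  by move=> uu; do 2!apply: connect_adj_consW.
have bb' : connect (adj E) b b' by apply: connect1; rewrite adj_cons eqxx.
rewrite !inE => /or3P[/eqP[-> ->]|/eqP[-> ->]|xy] //=; last first.
  by apply: sub; apply: connect1; rewrite /adj xy.
apply: connect_trans bb' _; apply: connect_trans (sub _ _ b'c') _.
by apply: connect1; rewrite !adj_cons eqxx !orbT.
Qed.

End Contraction.

(** * The graph of a cut sequent *)

Section ForestGraphs.
Variables (V : finType) (X : eqType).
Implicit Types (t u : tree V X) (G : forest V X) (f : {set V * V}).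
Implicit Types (D : seq (tree V X)) (c : seq (tree V X * tree V X)).

Lemma dual_atomK : involutive (@dual_atom X).
Proof. by case. Qed.

Lemma dualK : involutive (@dual X).
Proof. by elim=> [a|A IHA B IHB|A IHA B IHB] /=; rewrite ?dual_atomK ?IHA ?IHB. Qed.

Lemma root_vertices t : root t \in vertices t.
Proof. by case: t => *; rewrite /= mem_head. Qed.

Lemma subseq_leaf_names t : subseq (leaf_names t) (vertices t).
Proof.
rewrite /leaf_names; elim: t => [v a|v t IHt u IHu|v t IHt u IHu] /=;
  first (by rewrite eqxx); rewrite map_cat;
  by apply: subseq_trans (cat_subseq IHt IHu) (subseq_cons _ _).
Qed.

Lemma subseq_fleaves G : subseq (map fst (fleaves G)) (fvertices G).
Proof.
rewrite /fleaves /fvertices; elim: (trees G) => //= t ts IH.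
by rewrite map_cat cat_subseq // subseq_leaf_names.
Qed.

Lemma fleaf_vertex G l (a : atom X) : (l, a) \in fleaves G -> l \in fvertices G.
Proof. by move=> la; apply: (mem_subseq (subseq_fleaves G)); apply: (map_f fst la). Qed.

Lemma fleaf_label G l (a b : atom X) : cut_sequent G ->
  (l, a) \in fleaves G -> (l, b) \in fleaves G -> a = b.
Proof.
case=> _ /(subseq_uniq (subseq_fleaves G)) + _.
elim: (fleaves G) => //= -[k d] s IH /= /andP[ks /IH{}IH].
rewrite !inE => /orP[/eqP[lk ad]|la] /orP[/eqP[lk' bd]|lb]; first by rewrite ad bd.
- by case/mapP: ks; exists (l, b).
- by case/mapP: ks; exists (l, a).
- exact: IH.
Qed.

Lemma switched_edges_endpoints s t : endpoints_in (vertices t) (switched_edges s t).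
Proof.
have sub t' u' v : endpoints_in (vertices t') (switched_edges s t') ->
    endpoints_in (vertices u') (switched_edges s u') ->
    endpoints_in (v :: vertices t' ++ vertices u')
      (switched_edges s t' ++ switched_edges s u').
  move=> /allP Ht /allP Hu; apply/allP=> e; rewrite !inE !mem_cat.
  by case/orP=> [/Ht|/Hu] /andP[-> ->]; rewrite !orbT.
elim: t => [v a|v t IHt u IHu|v t IHt u IHu] //=.
  by rewrite !inE eqxx !mem_cat !root_vertices !orbT /=; apply: sub.
by rewrite !inE eqxx !mem_cat; case: (s v); rewrite root_vertices ?orbT /=; apply: sub.
Qed.

Lemma endpoints_switching s G f : leaf_function G f ->
  endpoints_in (fvertices G) (switching_edges s G ++ enum f).
Proof.
case=> fl _; rewrite /endpoints_in all_cat; apply/andP; split; last first.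
  apply/allP=> -[l m]; rewrite mem_enum => /fl[[a la _] [b /fleaf_vertex mb _]].
  by rewrite /= (fleaf_vertex la).
rewrite all_cat; apply/andP; split.
  rewrite /fvertices; elim: (trees G) => //= t ts IH; rewrite all_cat.
  apply/andP; split; [move: (switched_edges_endpoints s t) | move: IH];
    by apply: sub_all => e /andP[]; rewrite !mem_cat => -> ->; rewrite ?orbT.
rewrite /fvertices /trees map_cat flatten_cat.
have: endpoints_in
    (flatten [seq vertices t | t <- flatten [seq [:: p.1; p.2] | p <- cuts G]])
    [seq (root p.1, root p.2) | p <- cuts G].
  rewrite /endpoints_in; elim: (cuts G) => //= p c IH.
  rewrite !mem_cat !root_vertices !orbT /=.
  by move: IH; apply: sub_all => e /andP[]; rewrite !mem_cat => -> ->; rewrite ?orbT.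
by apply: sub_all => e /andP[]; rewrite !mem_cat => -> ->; rewrite ?orbT.
Qed.

Lemma fvertices_neq0 G : cut_sequent G -> fvertices G != [::].
Proof. by case: G => [[|t D] c] [] /= D0 _ _; [case: D0 | case: t {D0}]. Qed.

Definition count_tree (vs : seq V) es := connected vs es /\ size vs = (size es).+1.

Lemma switching_countP G f : cut_sequent G -> leaf_function G f ->
  switching_condition G f <->
  forall s, count_tree (fvertices G) (switching_edges s G ++ enum f).
Proof.
move=> cs lf; have vs0 := fvertices_neq0 cs; case: cs => _ uvs _.
split=> H s; have [A B] := is_tree_count uvs vs0 (endpoints_switching s lf).
- exact: A (H s).
- exact: B (H s).
Qed.

(** Brings the two trees of a cut to the front in a chosen order. It is generic in [F] to serve
    vertices, leaves and switched edges alike. *)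
Lemma perm_flatten_trees (T : eqType) (F : tree V X -> seq T) D c1 p c2 t u :
  cut_between p t u ->
  perm_eq (flatten (map F (trees (Forest D (c1 ++ p :: c2)))))
          (F t ++ F u ++ flatten (map F (trees (Forest D (c1 ++ c2))))).
Proof.
move=> ptu; rewrite /trees /= !map_cat /= !flatten_cat /= !map_cat /= !flatten_cat /=.
apply: (@perm_trans _ ((F p.1 ++ F p.2) ++ (flatten (map F D) ++
   flatten (map F (flatten [seq [:: q.1; q.2] | q <- c1]))) ++
   flatten (map F (flatten [seq [:: q.1; q.2] | q <- c2])))).
  by rewrite perm_sym perm_catCA -!catA.
by rewrite -!catA; case: ptu => -> //=; rewrite perm_catCA.
Qed.

Lemma mem_zipC (T : eqType) (x y : T) s s' :
  ((x, y) \in zip s s') = ((y, x) \in zip s' s).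
Proof.
elim: s s' => [|a s IH] [|b s'] //=; rewrite !inE IH; congr orb.
by rewrite !xpair_eqE andbC.
Qed.

Lemma dual_leaf_cut D c1 p c2 t u l l' : cut_between p t u ->
  dual_leaf (Forest D (c1 ++ p :: c2)) l l' =
  [|| (l, l') \in zip (leaf_names t) (leaf_names u),
      (l', l) \in zip (leaf_names t) (leaf_names u)
    | dual_leaf (Forest D (c1 ++ c2)) l l'].
Proof.
move=> ptu; rewrite /dual_leaf /= !has_cat /= orbCA [RHS]orbA; congr (_ || _).
by case: ptu => -> //=; rewrite orbC; congr orb; apply: mem_zipC.
Qed.

(** When [p = (u, t)] the cut edge is listed in reverse, so adjacency and length are compared
    instead of the lists up to permutation. *)
Lemma switching_cut s D c1 p c2 t u : cut_between p t u ->
  let E := (root t, root u) :: switched_edges s t ++ switched_edges s u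
             ++ switching_edges s (Forest D (c1 ++ c2)) in
  let n := size (switched_edges s t) + (size (switched_edges s u)
             + size (switching_edges s (Forest D (c1 ++ c2)))) in
  adj (switching_edges s (Forest D (c1 ++ p :: c2))) =2 adj E /\
  size (switching_edges s (Forest D (c1 ++ p :: c2))) = n.+1.
Proof.
move=> ptu E n.
have PE : perm_eq (switching_edges s (Forest D (c1 ++ p :: c2)))
    ((root p.1, root p.2) :: switched_edges s t ++ switched_edges s u
             ++ switching_edges s (Forest D (c1 ++ c2))).
  rewrite /switching_edges.
  apply: perm_trans (perm_cat (perm_flatten_trees _ D c1 c2 ptu) (perm_refl _)) _.
  rewrite -!catA; set R := flatten _; rewrite /= !map_cat /=.
  by rewrite !catA; exact: permEl (perm_catCA _ [:: _] _).
split; last by rewrite (perm_size PE) /n /= 2!size_cat.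
move=> x y; rewrite /adj !(perm_mem PE) !inE.
by case: ptu => -> //=; rewrite !xpair_eqE (andbC (y == _)) (andbC (x == _)) orbACA
  [X in X || _]orbC orbACA.
Qed.
End ForestGraphs.

(** * Compound cuts *)

Section TensorPar.
Variables (V : finType) (X : eqType).
Implicit Types (t u : tree V X) (G : forest V X) (f : {set V * V}).
Implicit Types (D : seq (tree V X)) (c : seq (tree V X * tree V X)).

Lemma adj_cat (es es' : seq (V * V)) x y :
  adj (es ++ es') x y = adj es x y || adj es' x y.
Proof. by rewrite /adj !mem_cat orbACA. Qed.

Lemma adj_perm (es es' : seq (V * V)) : perm_eq es es' -> adj es =2 adj es'.
Proof. by move=> /perm_mem E x y; rewrite /adj !E. Qed.

Lemma endpoints_in_adj (vs : seq V) es es' : adj es =2 adj es' ->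
  endpoints_in vs es -> endpoints_in vs es'.
Proof.
move=> E /allP H; apply/allP=> -[a b] ab /=.
have : adj es a b by rewrite E /adj ab.
by case/orP=> /H /andP[-> ->].
Qed.

Lemma mem_fleaves_cut D c1 p c2 t u : cut_between p t u ->
  fleaves (Forest D (c1 ++ p :: c2)) =i
    leaves t ++ leaves u ++ fleaves (Forest D (c1 ++ c2)).
Proof. by move=> ptu; apply/perm_mem/perm_flatten_trees. Qed.

Lemma perm_fvertices_cut D c1 p c2 t u : cut_between p t u ->
  perm_eq (fvertices (Forest D (c1 ++ p :: c2)))
    (vertices t ++ vertices u ++ fvertices (Forest D (c1 ++ c2))).
Proof. exact: perm_flatten_trees. Qed.

Lemma cut_sequent_cut D c1 p c2 t u : cut_between p t u ->
  cut_sequent (Forest D (c1 ++ p :: c2)) <->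
  [/\ uniq (vertices t ++ vertices u ++ fvertices (Forest D (c1 ++ c2))),
      formula_of u = dual (formula_of t)
    & cut_sequent (Forest D (c1 ++ c2))].
Proof.
move=> ptu; rewrite /cut_sequent (perm_uniq (perm_fvertices_cut D c1 c2 ptu)) /=.
rewrite !all_cat /=; set U := uniq _; set du := _ == _.
have duE : du <-> formula_of u = dual (formula_of t).
  rewrite /du; case: ptu => -> /=; first by split=> /eqP.
  by split=> [/eqP-> | ->]; rewrite dualK.
split=> [[D0 Utu /and3P[-> /duE -> ->]] | [Utu /duE-> [D0 _ /andP[-> ->]]]] //.
by split=> //; split=> //; move: Utu; rewrite /U !cat_uniq => /and5P[].
Qed.

Lemma switched_edges_ext s s' t : {in vertices t, s =1 s'} ->
  switched_edges s t = switched_edges s' t.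
Proof.
elim: t => [v a|v t IHt u IHu|v t IHt u IHu] //= H;
  rewrite ?(H v) ?mem_head // IHt ?IHu // => z zt; apply: H;
  by rewrite inE mem_cat zt ?orbT.
Qed.

(** Allows a switching to be changed at the par vertex of a cut without affecting the rest. *)
Lemma switching_edges_ext s s' G : {in fvertices G, s =1 s'} ->
  switching_edges s G = switching_edges s' G.
Proof.
rewrite /switching_edges /fvertices => H; congr (_ ++ _); congr flatten.
elim: (trees G) H => //= t ts IH H; rewrite IH => [|z zt].
  by congr cons; apply: switched_edges_ext => z zt; apply: H; rewrite mem_cat zt.
by apply: H; rewrite mem_cat zt orbT.
Qed.

Lemma leaf_function_eq G G' f : fleaves G =i fleaves G' ->
  leaf_function G f -> leaf_function G' f.
Proof.
move=> E [H1 H2]; split=> [l m /H1|l].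
  by case=> -[a + ?] [b + ?]; rewrite !E => la mb; split; [exists a|exists b].
by case=> a + na; rewrite -E => la; apply: H2; exists a.
Qed.

Lemma matching_eq G G' f : fleaves G =i fleaves G' ->
  matching G f -> matching G' f.
Proof.
move=> E M P; have [M1 M2] := M P; split=> [l m|m]; rewrite -!E; first exact: M1.
by case/M2=> l [[la lm] ul]; exists l; split=> [|l']; rewrite -E //; apply: ul.
Qed.

Lemma count_tree_same (vs vs' : seq V) es es' : perm_eq vs vs' ->
  adj es =2 adj es' -> size es = size es' -> count_tree vs es -> count_tree vs' es'.
Proof.
move=> pv E S [con sz]; split; last by rewrite -(perm_size pv) -S.
exact: connected_adj (perm_mem pv) E con.
Qed.

Lemma perm_fvertices_tensor_par D c1 p c2 v w tB tC uB uC :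
  cut_between p (TTensor v tB tC) (TPar w uB uC) ->
  perm_eq (fvertices (Forest D (c1 ++ p :: c2)))
    (v :: w :: fvertices (Forest D (c1 ++ [:: (tB, uB), (tC, uC) & c2]))).
Proof.
move=> ptu; have pB : cut_between (tB, uB) tB uB by left.
have pC : cut_between (tC, uC) tC uC by left.
apply/permP=> q; rewrite (permP (perm_fvertices_cut D c1 c2 ptu)) /= !count_cat /=.
rewrite (permP (perm_fvertices_cut D c1 _ pB)) !count_cat.
rewrite (permP (perm_fvertices_cut D c1 c2 pC)) !count_cat.
rewrite -!addnA; congr (_ + _); rewrite [RHS]addnCA; congr (_ + _).
by rewrite addnCA; congr (_ + _); exact: addnCA.
Qed.

(** The leaves and [f] do not change, so the work is in the switching condition, through
    [connected_tensor_par]. *)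
Lemma proof_net_tensor_par D c1 p c2 f v w tB tC uB uC :
  cut_between p (TTensor v tB tC) (TPar w uB uC) ->
  proof_net (Forest D (c1 ++ p :: c2)) f ->
  proof_net (Forest D (c1 ++ [:: (tB, uB), (tC, uC) & c2])) f.
Proof.
set G := Forest D (c1 ++ p :: c2); set G1 := Forest D (c1 ++ _ :: _ :: _).
set G0 := Forest D (c1 ++ c2).
move=> ptu [cs lf mt sw].
have pB : cut_between (tB, uB) tB uB by left.
have pC : cut_between (tC, uC) tC uC by left.
have lE : fleaves G =i fleaves G1.
  move=> l; rewrite (mem_fleaves_cut _ _ _ ptu) (mem_fleaves_cut D c1 _ pB).
  rewrite !mem_cat (mem_fleaves_cut D c1 _ pC) !mem_cat -/G0 -!orbA; congr orb.
  exact: orbCA.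
have vP : perm_eq (fvertices G) (v :: w :: fvertices G1).
  exact: perm_fvertices_tensor_par ptu.
have uvs : uniq (v :: w :: fvertices G1).
  by rewrite -(perm_uniq vP); case: cs.
have cs1 : cut_sequent G1.
  have [_ /= [dB dC] cs0] := (cut_sequent_cut D c1 c2 ptu).1 cs.
  have /= /and3P[_ _ u1] := uvs.
  apply/(cut_sequent_cut D c1 _ pB); split=> //.
    by rewrite -(perm_uniq (perm_fvertices_cut D c1 _ pB)).
  apply/(cut_sequent_cut D c1 _ pC); split=> //.
  rewrite -(perm_uniq (perm_fvertices_cut D c1 c2 pC)).
  move: u1; rewrite (perm_uniq (perm_fvertices_cut D c1 _ pB)).
  by rewrite !cat_uniq => /and5P[].
have lf1 := leaf_function_eq lE lf.
split=> //; first exact: matching_eq mt.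
apply/(switching_countP cs1 lf1) => s.
have {}sw := (switching_countP cs lf).1 sw.
(* The edges common to the graphs before and after the step. *)
set E0 := switched_edges s tB ++ switched_edges s tC ++ switched_edges s uB ++
  switched_edges s uC ++ switching_edges s G0 ++ enum f.
set E1 := [:: (root tB, root uB), (root tC, root uC) & E0].
have [A1 S1] : adj (switching_edges s G1 ++ enum f) =2 adj E1 /\
    size (switching_edges s G1 ++ enum f) = size E1.
  have [AB SB] := switching_cut s D c1 ((tC, uC) :: c2) pB.
  have [AC SC] := switching_cut s D c1 c2 pC.
  split; last first.
    rewrite size_cat SB SC /E1 /E0 [RHS]/= 5!size_cat -/G0.
    by rewrite !(addSn, addnS) -!addnA; congr _.+2; congr (_ + _); exact: addnCA.
  move=> x y; rewrite adj_cat AB adj_cons 2!adj_cat AC adj_cons 2!adj_cat.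
  rewrite /E1 /E0 2!adj_cons 5!adj_cat -/G0.
  do ![case: (_ == _); rewrite ?orbT //=]; do ![case: (adj _ _ _); rewrite ?orbT //=].
have wnin : w \notin fvertices G1 by case/and3P: uvs.
(* [w] is not a vertex of [G1], so [s] may be overridden there; both choices yield trees with the
   same edges [E0]. *)
have step b : let d := if b then root uB else root uC in
    count_tree (v :: w :: fvertices G1)
      [:: (v, w), (v, root tB), (v, root tC), (w, d) & E0].
  move=> d; pose s' z := if z == w then b else s z.
  have [A S] := switching_cut s' D c1 c2 ptu.
  have sub z : z \in vertices tB ++ vertices tC ++ vertices uB ++ vertices uC
      ++ fvertices G0 -> s' z = s z.
    move=> zG; have zG1 : z \in fvertices G1.
      rewrite (perm_mem (perm_fvertices_cut D c1 _ pB)) !mem_cat.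
      rewrite (perm_mem (perm_fvertices_cut D c1 c2 pC)) !mem_cat.
      by move: zG; rewrite !mem_cat => /or4P[->|->|->|/orP[->|->]]; rewrite ?orbT.
    by rewrite /s'; case: eqP zG1 => // ->; rewrite (negbTE wnin).
  have sw_t t : {subset vertices t <= vertices tB ++ vertices tC ++ vertices uB
      ++ vertices uC ++ fvertices G0} -> switched_edges s' t = switched_edges s t.
    by move=> H; apply: switched_edges_ext => z /H; apply: sub.
  have sw0 : switching_edges s' G0 = switching_edges s G0.
    by apply: switching_edges_ext => z zG0; apply: sub; rewrite !mem_cat zG0 !orbT.
  move: A S; rewrite -/G0 sw0 /= !sw_t; try by move=> z zt; rewrite !mem_cat zt ?orbT.
  rewrite /s' eqxx -/d => A S.
  have PE : perm_eq
      (((v, w) :: [:: (v, root tB), (v, root tC) &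
         switched_edges s tB ++ switched_edges s tC]
         ++ ((w, d) :: switched_edges s uB ++ switched_edges s uC)
         ++ switching_edges s G0) ++ enum f)
      [:: (v, w), (v, root tB), (v, root tC), (w, d) & E0].
    rewrite /E0 /= -!catA /= !perm_cons catA.
    by apply: perm_trans (permEl (perm_catCA _ [:: _] _)) _; rewrite /= -!catA.
  apply: count_tree_same vP _ _ (sw s') => [x y|].
  - by rewrite adj_cat A -adj_cat -(adj_perm PE).
  - rewrite size_cat S -(perm_size PE) [RHS]size_cat; congr (_ + _).
    by rewrite [RHS]/= !size_cat [in RHS]/= !size_cat !(addSn, addnS) !addnA.
have [tr1 sz1] := step true; have [tr2 _] := step false.
have E1in : endpoints_in (fvertices G1) E1.
  exact: endpoints_in_adj A1 (endpoints_switching s lf1).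
have E0in : endpoints_in (fvertices G1) E0 by case/and3P: E1in.
have [/andP[rB rB'] /andP[rC rC'] _] := and3P E1in.
split; last by rewrite S1; move: sz1 => /= [->].
apply: connected_adj (fun _ => erefl) (fun x y => esym (A1 x y)) _.
by apply: connected_tensor_par uvs E0in rB rC rB' rC' _ tr1 tr2; case: sz1.
Qed.
End TensorPar.

(** * Atomic cuts *)

Section DualLeaves.
Variables (V : finType) (X : eqType).

Lemma mem_zip (T : eqType) (x y : T) s s' :
  (x, y) \in zip s s' -> (x \in s) && (y \in s').
Proof.
elim: s s' => [|a s IH] [|b s'] //=; rewrite !inE => /orP[/eqP[-> ->]|/IH/andP[-> ->]];
  by rewrite ?eqxx ?orbT.
Qed.

Lemma dual_leaf_vertex (G : forest V X) l k : dual_leaf G l k ->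
  (l \in fvertices G) && (k \in fvertices G).
Proof.
case: G => D c; elim: c => [|[t u] c IH] //.
have ptu : cut_between (t, u) t u by left.
rewrite (dual_leaf_cut D [::] c l k ptu) !(perm_mem (perm_fvertices_cut D [::] c ptu)).
rewrite !mem_cat => /or3P[/mem_zip/andP[]|/mem_zip/andP[]|/IH/andP[-> ->]];
  last by rewrite !orbT.
all: do 2!move=> /(mem_subseq (subseq_leaf_names _))->.
all: by rewrite ?orbT.
Qed.

End DualLeaves.

Section AtomicCut.
Variables (V : finType) (X : eqType) (D : seq (tree V X)).
Variables (c1 c2 : seq (tree V X * tree V X)) (p : tree V X * tree V X).
Variables (f : {set V * V}) (x y : V) (a : atom X).
Let G := Forest D (c1 ++ p :: c2).
Let G' := Forest D (c1 ++ c2).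
Hypotheses (pn : proof_net G f) (pos_a : positive a).
Hypothesis pxy : cut_between p (TLeaf x a) (TLeaf y (dual_atom a)).

Let mem_fleavesG l :
  (l \in fleaves G) = [|| l == (x, a), l == (y, dual_atom a) | l \in fleaves G'].
Proof. by rewrite (mem_fleaves_cut D c1 c2 pxy) !inE. Qed.

Let perm_fverticesG : perm_eq (fvertices G) [:: x, y & fvertices G'].
Proof. exact: perm_fvertices_cut pxy. Qed.

Let uniqG : uniq [:: x, y & fvertices G'].
Proof. by rewrite -(perm_uniq perm_fverticesG); case: pn => -[]. Qed.

Let neq_xy : x != y.
Proof. by have := uniqG; rewrite /= inE negb_or => /andP[/andP[]]. Qed.

Let fresh z : z \in fvertices G' -> (z != x) && (z != y).
Proof.
move=> zG; have := uniqG; rewrite /= inE negb_or -andbA => /and4P[_ nx ny _].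
by apply/andP; split; [apply: contraNneq nx | apply: contraNneq ny] => <-.
Qed.

Let cut_sequentG' : cut_sequent G'.
Proof. by case: pn => /(cut_sequent_cut D c1 c2 pxy)[]. Qed.

Let functional l k k' : (l, k) \in f -> (l, k') \in f -> k = k'.
Proof.
case: pn => _ [lf1 lf2] _ _ lk; have [/lf2[m [_ um]] _] := lf1 _ _ lk.
by move=> /um <-; apply/esym/um.
Qed.

Lemma positive_dual_atom (b : atom X) : positive (dual_atom b) = ~~ positive b.
Proof. by case: b. Qed.

Let neg_leafG l : neg_leaf G l <-> l = y \/ neg_leaf G' l.
Proof.
split=> [[b]|[->|[b lb nb]]]; last 2 first.
- by exists (dual_atom a); rewrite ?mem_fleavesG ?eqxx ?orbT // positive_dual_atom pos_a.
- by exists b; rewrite // mem_fleavesG lb !orbT.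
rewrite mem_fleavesG => /or3P[/eqP[_ ->]|/eqP[-> _]|lb] nb.
- by rewrite pos_a in nb.
- by left.
- by right; exists b.
Qed.

Let pos_leafG k : pos_leaf G k <-> k = x \/ pos_leaf G' k.
Proof.
split=> [[b]|[->|[b lb nb]]]; last 2 first.
- by exists a; rewrite // mem_fleavesG eqxx.
- by exists b; rewrite // mem_fleavesG lb !orbT.
rewrite mem_fleavesG => /or3P[/eqP[-> _]|/eqP[_ ->]|lb] nb.
- by left.
- by rewrite positive_dual_atom pos_a in nb.
- by right; exists b.
Qed.

Let neg_leaf_neq l : neg_leaf G' l -> (l != x) && (l != y).
Proof. by case=> b /fleaf_vertex/fresh. Qed.

Let pos_leaf_neq k : pos_leaf G' k -> (k != x) && (k != y).
Proof. by case=> b /fleaf_vertex/fresh. Qed.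

Let source l k : (l, k) \in f -> l = y \/ neg_leaf G' l.
Proof. by case: pn => _ [lf1 _] _ _ /lf1[/neg_leafG]. Qed.

Let target l k : (l, k) \in f -> k = x \/ pos_leaf G' k.
Proof. by case: pn => _ [lf1 _] _ _ /lf1[_ /pos_leafG]. Qed.

Let switching s : count_tree [:: x, y & fvertices G']
  ((x, y) :: switching_edges s G' ++ enum f).
Proof.
have [cs lf _ sw] := pn; have {}sw := (switching_countP cs lf).1 sw s.
have [A S] := switching_cut s D c1 c2 pxy.
apply: count_tree_same perm_fverticesG _ _ sw => [u v|].
  by rewrite adj_cat A -adj_cat.
by rewrite size_cat S [RHS]/= [in RHS]size_cat.
Qed.

(* If f(y) were x, the edge {y, x} of f would be parallel to the cut. *)
Let exists_target : exists2 m, (y, m) \in f & pos_leaf G' m.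
Proof.
have [cs lf _ _] := pn.
have [m [ym _]] := lf.2 _ ((neg_leafG y).2 (or_introl erefl)).
exists m => //; case: (target ym) => // mx; rewrite {}mx in ym.
have [con sz] := switching (fun _ => true).
set E := _ ++ _ in con sz.
(* The cut edge adds no adjacency to that of the edge [(y, x)] of [f]; without it the graph would
   stay connected with one edge too few. *)
have EE : adj ((x, y) :: E) =2 adj E.
  move=> u v; rewrite adj_cons.
  have yx : (y, x) \in E by rewrite mem_cat mem_enum ym orbT.
  by case: eqP => [[-> ->]|_]; [|case: eqP => [[-> ->]|]];
    rewrite /adj ?yx ?orbT.
have EI : endpoints_in [:: x, y & fvertices G'] ((x, y) :: E).
  apply: (@endpoints_in_adj _ _ (switching_edges (fun=> true) G ++ enum f)).
    have [A _] := switching_cut (fun=> true) D c1 c2 pxy.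
    by move=> u v; rewrite adj_cat A -adj_cat.
  have := endpoints_switching (fun=> true) lf; apply: sub_all => e.
  by rewrite !(perm_mem perm_fverticesG).
have con' : connected [:: x, y & fvertices G'] E.
  exact: connected_adj (fun _ => erefl) EE con.
have := connected_size uniqG isT _ con'; rewrite sz ltnn => H.
by exfalso; have /andP[_ /H] := EI.
Qed.

Let in_reset m l k : (y, m) \in f -> m != x ->
  ((l, k) \in reset f x y) =
  (l != y) && (((k != x) && ((l, k) \in f)) || (((l, x) \in f) && (k == m))).
Proof.
move=> ym mx; rewrite inE /=; congr (_ && (_ || (_ && _))).
by apply/idP/eqP => [yk|->//]; apply: functional yk ym.
Qed.

Lemma leaf_function_reset : leaf_function G' (reset f x y).
Proof.
have [m ym pm] := exists_target; have /andP[mx _] := pos_leaf_neq pm.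
split=> [l k|l nl].
  rewrite (in_reset _ _ ym mx) => /andP[ly /orP[/andP[kx lk]|/andP[lx /eqP->]]].
    case: (source lk) (target lk) => [/eqP|nl]; first by rewrite (negbTE ly).
    by case=> [/eqP|]; first by rewrite (negbTE kx).
  by case: (source lx) => [/eqP|]; first by rewrite (negbTE ly).
have [_ [_ lf2] _ _] := pn.
have [k [lk uk]] := lf2 _ ((neg_leafG l).2 (or_intror nl)).
have /andP[lx ly] := neg_leaf_neq nl.
exists (if k == x then m else k); split=> [|k'].
  rewrite (in_reset _ _ ym mx) ly; have [kx|kx] := eqVneq k x.
    by rewrite -kx lk eqxx orbT.
  by rewrite kx lk.
rewrite (in_reset _ _ ym mx) ly /= => /orP[/andP[k'x lk']|/andP[lx' /eqP->]].
  by rewrite (uk _ lk') (negbTE k'x).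
by rewrite (uk _ lx') eqxx.
Qed.

(** If an edge into [x] leaves a dual variable of [P], then [x] is labelled [P] and [y] by its dual,
    so [f] sends [y] to a leaf labelled [P] again. *)
Lemma matching_reset : matching G' (reset f x y).
Proof.
have [cs _ mt _] := pn.
have [m ym pm] := exists_target; have /andP[mx _] := pos_leaf_neq pm.
have xa : (x, a) \in fleaves G by rewrite mem_fleavesG eqxx.
have ya : (y, dual_atom a) \in fleaves G by rewrite mem_fleavesG eqxx orbT.
have sub l : l \in fleaves G' -> l \in fleaves G.
  by rewrite mem_fleavesG => ->; rewrite !orbT.
move=> P; have [M1 M2] := mt P.
have yP l : (l, DualVar P) \in fleaves G -> (l, x) \in f ->
    (y, DualVar P) \in fleaves G.
  move=> lP lx; have /(fleaf_label cs xa) aP := M1 _ _ lP lx.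
  by move: ya; rewrite aP.
split=> [l k lP|k kP].
  rewrite (in_reset _ _ ym mx) => /andP[ly /orP[/andP[kx lk]|/andP[lx /eqP->]]].
    have := M1 _ _ (sub _ lP) lk.
    rewrite mem_fleavesG !xpair_eqE (negbTE kx) /= => /orP[/andP[_]|//].
    by move/eqP/(congr1 (@positive X)); rewrite positive_dual_atom pos_a.
  have := M1 _ _ (yP _ (sub _ lP) lx) ym.
  rewrite mem_fleavesG !xpair_eqE (negbTE mx) /= => /orP[/andP[_]|//].
  by move/eqP/(congr1 (@positive X)); rewrite positive_dual_atom pos_a.
have [l [[lP lk] ul]] := M2 _ (sub _ kP).
have /andP[kx ky] := fresh (fleaf_vertex kP).
have restrict z : (z, DualVar P) \in fleaves G -> z != y -> (z, DualVar P) \in fleaves G'.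
  rewrite mem_fleavesG !xpair_eqE => /or3P[/andP[_ /eqP aP]|/andP[->]|] //.
  by move: pos_a; rewrite -aP.
have [ly|ly] := eqVneq l y; last first.
  exists l; split=> [|l' [l'P]].
    by split; [apply: restrict | rewrite (in_reset _ _ ym mx) ly kx lk].
  rewrite (in_reset _ _ ym mx) => /andP[l'y /orP[/andP[_ l'k]|/andP[l'x /eqP km]]].
    by apply: ul; split; [apply: sub|].
  have ly' : l = y by apply: ul; rewrite km; split=> //; apply: yP l'x; apply: sub.
  by rewrite ly' eqxx in ly.
(* The preimage of [k] was the deleted leaf [y]; the preimage of [x] takes its place. *)
subst l; have km := functional lk ym; subst k.
have aP : a = Var P.
  by have := fleaf_label cs ya lP; case: (a) => //= Q [->].
rewrite aP in xa; have [l [[l1 l2] ul']] := M2 x xa.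
have ly : l != y.
  by apply: contraNneq mx => ly; rewrite ly in l2; rewrite (functional l2 ym).
exists l; split=> [|l' [l'P]].
  by split; [apply: restrict | rewrite (in_reset _ _ ym mx) ly l2 eqxx orbT].
rewrite (in_reset _ _ ym mx) => /andP[l'y /orP[/andP[_ l'k]|/andP[l'x _]]].
  by case/eqP: l'y; apply/esym/ul; split=> //; apply: sub.
by apply: ul'; split=> //; apply: sub.
Qed.

(** The edge out of [y] disappears, and the others are redirected injectively, because an edge of
    [f] is determined by its source. *)
Lemma card_reset : #|f| = #|reset f x y|.+1.
Proof.
have [m ym pm] := exists_target; have /andP[mx _] := pos_leaf_neq pm.
pose h (e : V * V) := (e.1, if e.2 == x then m else e.2).
have -> : reset f x y = h @: (f :\ (y, m)).
  apply/setP=> -[l k]; rewrite (in_reset _ _ ym mx); apply/idP/imsetP.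
    case/andP=> ly /orP[/andP[kx lk]|/andP[lx /eqP->]].
      by exists (l, k); rewrite ?inE ?xpair_eqE ?(negbTE ly) // /h /= (negbTE kx).
    by exists (l, x); rewrite ?inE ?xpair_eqE ?(negbTE ly) // /h /= eqxx.
  case=> -[l' k'] /setD1P[ne lk] [-> ->].
  have ly : l' != y.
    apply: contraNneq ne => ly; subst l'.
    by rewrite xpair_eqE eqxx (functional lk ym) /=.
  rewrite ly /=; have [k'x|k'x] := eqVneq k' x; last by rewrite k'x lk.
  by rewrite -k'x lk eqxx orbT.
rewrite card_in_imset ?(cardsD1 (y, m) f) ?ym //.
move=> [l k] [l' k'] /setD1P[_ lk] /setD1P[_ lk'] [ll _]; subst l'.
by rewrite (functional lk lk').
Qed.

(* Sending x and y to f(y) contracts the path formed by the cut and the edge  *)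
(* of f out of y.                                                             *)
Lemma proof_net_reset : proof_net G' (reset f x y).
Proof.
split; [exact: cut_sequentG' | exact: leaf_function_reset
      | exact: matching_reset |].
apply/(switching_countP cut_sequentG' leaf_function_reset) => s.
have [con sz] := switching s; split; last first.
  by move: sz; rewrite /= !size_cat -!cardE card_reset addnS => -[].
have [m ym pm] := exists_target; have /andP[mx _] := pos_leaf_neq pm.
pose h z := if (z == x) || (z == y) then m else z.
have hid : {in fvertices G', h =1 id}.
  by move=> z /fresh/andP[/negbTE zx /negbTE zy]; rewrite /h zx zy.
apply: (connected_map _ hid) con => [z zG|u v]; first by rewrite !inE zG !orbT.
rewrite !inE mem_cat mem_enum => /or3P[/eqP[-> ->]|uv|uv].
- by rewrite /h !eqxx orbT.
- have := endpoints_switching s leaf_function_reset.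
  rewrite /endpoints_in all_cat => /andP[/allP/(_ _ uv)/andP[/= uG vG] _].
  by rewrite !hid //; apply: connect1; rewrite adj_cat {1}/adj uv.
have hx : h x = m by rewrite /h eqxx.
case: (source uv) => [uy|nu].
  subst u; rewrite (functional uv ym) /h eqxx orbT.
  by have /andP[_ /negbTE->] := pos_leaf_neq pm; rewrite (negbTE mx).
have /andP[ux uy] := neg_leaf_neq nu.
have -> : h u = u by rewrite /h (negbTE ux) (negbTE uy).
apply: connect1; rewrite /adj mem_cat mem_enum (in_reset _ _ ym mx) uy /=.
case: (target uv) => [vx|pv]; first by subst v; rewrite hx uv eqxx !orbT.
have /andP[vx vy] := pos_leaf_neq pv.
by rewrite /h (negbTE vx) (negbTE vy) vx uv /= !orbT.
Qed.

Let mem_concl_neq z : z \in map fst (fleaves (erase_cuts G)) ->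
  (z != x) && (z != y).
Proof.
case/mapP=> -[z' b] zb ->; apply: fresh; apply: (@fleaf_vertex _ _ _ _ b).
move: zb; rewrite /fleaves /trees /= cats0 => zb.
by rewrite map_cat flatten_cat mem_cat zb.
Qed.

(** A path for the reset function is a path for [f] in which each passage through the eliminated cut
    has been shortcut. *)
Lemma path_normal_form_reset :
  path_normal_form G' (reset f x y) = path_normal_form G f.
Proof.
have [m ym pm] := exists_target; have /andP[mx _] := pos_leaf_neq pm.
have dualG l k : dual_leaf G l k =
    [|| (l == x) && (k == y), (l == y) && (k == x) | dual_leaf G' l k].
  rewrite (dual_leaf_cut D c1 c2 l k pxy) /= !inE !xpair_eqE.
  by rewrite (andbC (k == x)).
have dual_neq l k : dual_leaf G' l k -> (l != x) && (k != y).
  by case/dual_leaf_vertex/andP=> /fresh/andP[-> _] /fresh/andP[].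
(* A step along a redirected edge unfolds into two steps of [f], with [y] in between. *)
have tcG l k : l != y -> through_cut G' (reset f x y) l k ->
    connect (through_cut G f) l k.
  move=> ly /existsP[k' /andP[]]; rewrite (in_reset _ _ ym mx) ly /=.
  case/orP=> [/andP[_ lk]|/andP[lx /eqP->]] d.
    by apply: connect1; apply/existsP; exists k'; rewrite lk dualG d !orbT.
  apply: (@connect_trans _ _ y); apply: connect1; apply/existsP.
    by exists x; rewrite lx dualG !eqxx.
  by exists m; rewrite ym dualG d !orbT.
apply/setP=> -[l n]; rewrite !inE /=.
have [/mem_concl_neq/andP[lx ly]|//] := boolP (l \in _).
have [/mem_concl_neq/andP[nx ny]|//] := boolP (n \in _).
rewrite /=; apply/existsP/existsP => -[k /andP[lk kn]].
  (* Paths for the reset function never visit [y], since dual leaves in [G'] avoid it. *)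
  have lk' : (k != y) && connect (through_cut G f) l k.
    case/connectP: lk => q; elim: q l {lx} ly => [|z q IH] l ly /=.
      by move=> _ ->; rewrite ly connect0.
    case/andP=> lz /IH{}IH /IH{IH} H.
    have zy : z != y.
      by case/existsP: lz => k' /andP[_ /dual_neq/andP[]].
    case/andP: (H zy) => -> /(connect_trans (tcG _ _ ly lz)) ->; by [].
  case/andP: lk' => ky lk'; move: kn; rewrite (in_reset _ _ ym mx) ky nx /=.
  case/orP=> [kn|/andP[kx /eqP nm]]; first by exists k; rewrite lk'.
  exists y; rewrite nm ym andbT; apply: connect_trans lk' (connect1 _).
  by apply/existsP; exists x; rewrite kx dualG !eqxx.
pose good z := exists k, connect (through_cut G' (reset f x y)) z k
                 && ((k, n) \in reset f x y).
(* A path through y enters it by an edge of f into x, which resetting sends   *)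
(* directly to the leaf reached from y.                                       *)
suff [] : (l != y -> good l) /\
    (l = y -> forall z, z != y -> (z, x) \in f -> good z) by move/(_ ly).
case/connectP: lk kn => q; elim: q l {lx ly} => [|z q IH] l /=.
  move=> _ -> ln; split=> [ly|ly z zy zx].
    by exists l; rewrite connect0 (in_reset _ _ ym mx) ly nx ln.
  exists z; rewrite connect0 (in_reset _ _ ym mx) zy zx /=; apply/orP; right.
  by apply/eqP; apply: (functional _ ym); rewrite -ly.
case/andP=> /existsP[k' /andP[lk']]; rewrite dualG => d pq zk kn.
have [good_z good_y] := IH z pq zk kn.
have step w : w != y -> (w, k') \in reset f x y -> dual_leaf G' k' z -> good w.
  move=> wy wk' dz; have /andP[_ zy] := dual_neq _ _ dz.
  have [k2 /andP[zk2 k2n]] := good_z zy; exists k2; rewrite k2n andbT.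
  apply: connect_trans zk2; apply: connect1; apply/existsP.
  by exists k'; rewrite wk' dz.
have k'y : k' != y.
  by case: (target lk') => [->|/pos_leaf_neq/andP[]]; first exact: neq_xy.
rewrite (negbTE k'y) /= in d; split=> [ly|ly].
  case/orP: d => [/andP[/eqP k'x /eqP zy]|d].
    by apply: good_y zy _ ly _; rewrite -k'x.
  apply: step => //; rewrite (in_reset _ _ ym mx) ly lk'.
  by have /andP[->] := dual_neq _ _ d.
rewrite ly in lk'; have k'm := functional lk' ym; subst k'.
rewrite (negbTE mx) /= in d => z' z'y z'x; apply: step => //.
by rewrite (in_reset _ _ ym mx) z'y z'x eqxx orbT.
Qed.

End AtomicCut.

(** * Normalization *)

Section Normalization.
Variables (V : finType) (X : eqType).
Implicit Types (t u : tree V X) (G : forest V X) (f : {set V * V}).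
Implicit Types (S : forest V X * {set V * V}).

Lemma size_leaf_names_dual t u : formula_of u = dual (formula_of t) ->
  size (leaf_names u) = size (leaf_names t).
Proof.
rewrite /leaf_names; elim: t u => [v a|v t1 IH1 t2 IH2|v t1 IH1 t2 IH2]
  [w b|w u1 u2|w u1 u2] //= [d1 d2];
  by rewrite !map_cat !size_cat (IH1 u1) // (IH2 u2).
Qed.

Lemma eq_path_normal_form G G' f : concl G = concl G' ->
  dual_leaf G =2 dual_leaf G' -> path_normal_form G f = path_normal_form G' f.
Proof.
move=> cE dE; rewrite /path_normal_form /erase_cuts cE; apply/setP=> e.
rewrite !inE; congr [&& _, _ & _]; apply: eq_existsb => k; congr (_ && _).
by apply: eq_connect => l m; apply: eq_existsb => z; rewrite dE.
Qed.

(** Dual formulas have equally many leaves, so the pairing of i-th leaves splits into the pairings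
    of the two new cuts, and [dual_leaf] is unchanged. *)
Lemma path_normal_form_tensor_par D c1 (p : tree V X * tree V X) c2 f v w
    tB tC uB uC :
  cut_between p (TTensor v tB tC) (TPar w uB uC) ->
  cut_sequent (Forest D (c1 ++ p :: c2)) ->
  path_normal_form (Forest D (c1 ++ [:: (tB, uB), (tC, uC) & c2])) f
    = path_normal_form (Forest D (c1 ++ p :: c2)) f.
Proof.
move=> ptu /(cut_sequent_cut D c1 c2 ptu)[_ /= [dB dC] _].
apply: eq_path_normal_form => // l k; rewrite (dual_leaf_cut _ _ _ _ _ ptu).
have pB : cut_between (tB, uB) tB uB by left.
have pC : cut_between (tC, uC) tC uC by left.
rewrite (dual_leaf_cut _ _ _ _ _ pB) (dual_leaf_cut _ _ _ _ _ pC).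
rewrite /leaf_names /= !map_cat zip_cat ?mem_cat; last first.
  by have := size_leaf_names_dual dB.
by rewrite -!orbA; congr orb; rewrite [RHS]orbCA.
Qed.

Lemma cut_step_invariant S S' : cut_step S S' ->
  [/\ proof_net S'.1 S'.2, erase_cuts S'.1 = erase_cuts S.1,
      path_normal_form S'.1 S'.2 = path_normal_form S.1 S.2
    & size (fvertices S'.1) < size (fvertices S.1)].
Proof.
case=> [D f c1 p c2 x y a pn pa pxy|D f c1 p c2 v w tB tC uB uC pn ptu] /=.
  split=> //; first exact: proof_net_reset pn pa pxy.
    exact: path_normal_form_reset pn pa pxy.
  by rewrite (perm_size (perm_fvertices_cut D c1 c2 pxy)) /= leqW.
split=> //; first exact: proof_net_tensor_par ptu pn.
  by apply: path_normal_form_tensor_par ptu _; case: pn.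
by rewrite (perm_size (perm_fvertices_tensor_par D c1 c2 ptu)) /= leqW.
Qed.

Lemma cut_step_progress G f : proof_net G f -> cuts G <> [::] ->
  exists S, cut_step (G, f) S.
Proof.
case: G => D [|[t u] c] // pn _; have [cs _ _ _] := pn.
have ptu : cut_between (t, u) t u by left.
have [_ + _] := (cut_sequent_cut D [::] c ptu).1 cs.
case: t pn {cs ptu} => [v a|v t1 t2|v t1 t2]; case: u => [w b|w u1 u2|w u1 u2] //= pn.
- case=> bE; rewrite {b}bE in pn *; have [pa|na] := boolP (positive a).
    eexists; apply: (@StepAtom _ _ D f [::] _ c v w a) => //; by left.
  (* Here the positive leaf is [w], so the two trees exchange roles. *)
  eexists; apply: (@StepAtom _ _ D f [::] _ c w v (dual_atom a)) => //.
    by rewrite positive_dual_atom.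
  by rewrite dual_atomK; right.
- move=> _; eexists; apply: (@StepCompound _ _ D f [::] _ c v w t1 t2 u1 u2) => //.
  by left.
- move=> _; eexists; apply: (@StepCompound _ _ D f [::] _ c w v u1 u2 t1 t2) => //.
  by right.
Qed.

Lemma cut_step_cuts S S' : cut_step S S' -> cuts S.1 <> [::].
Proof. by case=> [D f [|q c1] p c2|D f [|q c1] p c2]. Qed.

(** Without cuts there are no dual leaves, so only paths made of a single edge of [f] remain. *)
Lemma path_normal_form_cut_free G f : leaf_function G f -> cuts G = [::] ->
  path_normal_form G f = f.
Proof.
move=> [lf _] cG; have eG : erase_cuts G = G by case: G cG {lf} => D c /= ->.
apply/setP=> -[l k]; rewrite !inE eG /=; apply/and3P/idP.
  case=> _ _ /existsP[z /andP[/connectP[[|m q] /= + ->] //]].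
  by case/andP=> /existsP[n]; rewrite /dual_leaf cG andbF.
move=> lk; have [[a la _] [b kb _]] := lf _ _ lk.
split; [exact: (map_f fst la) | exact: (map_f fst kb)|].
by apply/existsP; exists l; rewrite connect0.
Qed.

(** The number of vertices decreases. [S] is arbitrary because [cut_step] itself demands a proof net
    at its source. *)
Lemma cut_step_terminating S : cut_terminating S.
Proof.
have [n le_n] := ubnP (size (fvertices S.1)).
elim: n S le_n => [|n IH] S le_n; first by rewrite ltn0 in le_n.
constructor=> S' /cut_step_invariant[_ _ _ lt]; apply: IH.
exact: leq_trans lt le_n.
Qed.

Lemma cut_normal_form_unique S S' : cut_normal_form_of S S' ->
  proof_net S.1 S.2 ->
  proof_net S'.1 S'.2 /\ S' = (erase_cuts S.1, path_normal_form S.1 S.2).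
Proof.
case=> steps; elim: steps => {S S'} [[G f] normal pn|S1 S2 S3 step _ IH normal _].
  have cG : cuts G = [::].
    by case E: (cuts G) => //; have [|S /normal] := cut_step_progress pn; rewrite ?E.
  split=> //=; case: pn => _ /path_normal_form_cut_free -> // _ _.
  by case: G cG {normal} => D c /= ->.
have [pn <- <- _] := cut_step_invariant step; exact: IH.
Qed.

Lemma cut_normal_form_exists S : proof_net S.1 S.2 ->
  exists S', cut_normal_form_of S S'.
Proof.
elim: (cut_step_terminating S) => {}S _ IH pn.
case E: (cuts S.1) => [|q c].
  by exists S; split=> [|S' /cut_step_cuts]; [constructor|rewrite E].
have [|S1 step] := cut_step_progress pn; first by rewrite E.
rewrite -surjective_pairing in step.
have [pn1 _ _ _] := cut_step_invariant step.
have [S' [steps normal]] := IH _ step pn1; exists S'; split=> //.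
exact: Relation_Operators.rt1n_trans step steps.
Qed.

End Normalization.

Theorem mainTheorem5 (V : finType) (X : eqType)
    (G : forest V X) (f : {set V * V}) :
  proof_net G f ->
  [/\ cut_terminating (G, f),
      forall S : forest V X * {set V * V},
        cut_normal_form_of (G, f) S
          <-> S = (erase_cuts G, path_normal_form G f)
    & proof_net (erase_cuts G) (path_normal_form G f)].
Proof.
move=> pn; have [S' nS'] := @cut_normal_form_exists _ _ (G, f) pn.
have [pnS' S'E] := cut_normal_form_unique nS' pn.
rewrite S'E in nS' pnS'; split; [exact: cut_step_terminating | | exact: pnS'].
move=> S; split=> [nS|->]; last exact: nS'.
by have [_ ->] := cut_normal_form_unique nS pn.
Qed.
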